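(* For every integer $s\geq 2$ there is a constant $C_s$ depending only on $s$ such that for all integers $t\geq 2$, $r\geq 3$ and every positive integer $n$, $$\mathrm{ex}(n,K_{s,t}^{(r)})\leq C_{s}\, t^{\frac{1}{s-1}}n^{r-\frac{1}{s-1}}.$$ In particular, there is an absolute constant $C$ such that $\mathrm{ex}(n,K_{2,t}^{(3)})\leq Ctn^2$ for all $t\ge 2$ and all $n$.
   Context: For an $r$-uniform hypergraph $H$, $\mathrm{ex}(n,H)$ denotes the largest number of edges in an $r$-uniform hypergraph on $n$ vertices containing no copy of $H$ (as a not necessarily induced subhypergraph). For positive integers $r,s,t$, $K_{s,t}^{(r)}$ denotes the $r$-uniform hypergraph whose vertex set is the union of pairwise disjoint sets $X,Y_1,\dots,Y_t$ with $|X|=s$ and $|Y_1|=\dots=|Y_t|=r-1$, and whose edge set is $\{\{x\}\cup Y_i : x\in X,\ 1\leq i\leq t\}$. *)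

(* Defs.v *)
From mathcomp Require Import all_boot.

Set Implicit Arguments.
Unset Strict Implicit.
Unset Printing Implicit Defensive.

(* A hypergraph on the vertex set [V] is identified with its edge set. *)
Definition uniform (r : nat) (V : finType) (G : {set {set V}}) : bool :=
  [forall e in G, #|e| == r].

(* [G] has a (not necessarily induced) subhypergraph isomorphic to [H]. *)
Definition contains_copy (V W : finType) (G : {set {set V}})
    (H : {set {set W}}) : bool :=
  [exists f : {ffun W -> V},
     injectiveb f && [forall e in H, [set f x | x in e] \in G]].

Definition turan (r n : nat) (W : finType) (H : {set {set W}}) : nat :=
  \max_(G : {set {set 'I_n}} | uniform r G && ~~ contains_copy G H) #|G|.

(* Vertices of K_{s,t}^{(r)}: [inl x] ranges over X, and [inr (i, j)] is the
   j-th element of Y_i. *)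
Definition Kvertex (s t r : nat) : finType := ('I_s + 'I_t * 'I_r.-1)%type.

Definition Kblock (s t r : nat) (i : 'I_t) : {set Kvertex s t r} :=
  [set inr (i, j) | j : 'I_r.-1].

Definition Kst (s t r : nat) : {set {set Kvertex s t r}} :=
  [set inl x |: Kblock s r i | x : 'I_s, i : 'I_t].

(* Main.v *)
(** For each [s]-set [X], a maximal matching in the common link of [X] yields a
    set [C X] of fewer than [(r-1)t] vertices meeting every member of that link.
    Put [F v x = #{X : x \in X, v \in C X}], so that the sum of [F] is at most
    [(r-1)ts n^s].  Let [e] be an edge, [x \in e] such that [e :\ x] has maximal
    degree [d] among the [(r-1)]-subsets of [e].  Every [s]-set containing [x]
    inside the neighbourhood of [e :\ x] is hit by some [v \in e :\ x], hence
    [F v x >= 'C(d-1, s-1) / (r-1)] for some such [v].  By maximality of [d] the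
    same holds with [d] replaced by the degree of some [Y] with
    [v, x \in Y \subset e] and [#|Y| = r-1], which exists as [r >= 3].  Edges with
    an [(r-1)]-subset of degree below [m] number at most [m n^(r-1)], and
    summing the degrees over the triples [(v, x, Y)] bounds the number of the
    others by [O_s(t n^(s+r-3) / m^(s-2))].  Both are [O_s(m n^(r-1))] once
    [m^(s-1) >= t n^(s-2)].  The factors [r-1] are absorbed by ['C(n, r-3)],
    which counts the choices of [Y] given [v] and [x]. *)
Require Import Defs.
From mathcomp Require Import all_boot all_order all_algebra zify ring.
From mathcomp Require Import reals exp.
Import Order.TTheory GRing.Theory Num.Theory.

Set Implicit Arguments.
Unset Strict Implicit.
Unset Printing Implicit Defensive.

(** * Estimates for unions, powers, falling factorials and binomials *)

Lemma leq_card_bigcup (I T : finType) (P : pred I) (A : I -> {set T}) :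
  #|\bigcup_(i | P i) A i| <= \sum_(i | P i) #|A i|.
Proof.
elim/big_rec2: _ => [|i m B _ le_mB]; first by rewrite cards0.
by rewrite (leq_trans (leq_card_setU _ _)) ?leq_add2l.
Qed.

Lemma leq_ffact_exp n k : n ^_ k <= n ^ k.
Proof.
by elim: k => // k IHk; rewrite ffactnSr expnSr leq_mul ?leq_subr.
Qed.

Lemma leq_bin_exp n k : 'C(n, k) <= n ^ k.
Proof.
apply: leq_trans (leq_ffact_exp n k).
by rewrite -bin_ffact leq_pmulr ?fact_gt0.
Qed.

Lemma leq_exp_ffact n k : (n - k) ^ k <= n ^_ k.
Proof.
elim: k => // k IHk; rewrite ffactnSr expnSr leq_mul //; last by lia.
apply: leq_trans IHk; case: k => // k; rewrite leq_exp2r //; lia.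
Qed.

(** Once [d >= 2 * (s + 1)], one has [d <= 2 * (d - 1 - s)], and every factor of [d.-1 ^_ s] is at
    least [d - 1 - s]. *)
Lemma leq_exp_bin d s : s.+1.*2 <= d ->
  d ^ s <= 2 ^ s * s`! * 'C(d.-1, s).
Proof.
move=> le_sd; rewrite -mulnA [s`! * _]mulnC bin_ffact.
apply: leq_trans (leq_mul (leqnn _) (leq_exp_ffact _ _)).
by rewrite -expnMn; case: s le_sd => // s le_sd; rewrite leq_exp2r //; lia.
Qed.

(** Absorbs two factors [r - 1 = k.+2], which keeps the final constant independent of [r]; the 9 is
    attained at [k = 1]. *)
Lemma leq_sqr_fact k : k.+2 ^ 2 <= 9 * k`!.
Proof.
elim: k => // k IHk; rewrite factS.
(* The factor [k + 1] gained on the right is too small when [k = 0]; that case is computed. *)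
case: k IHk => // k IHk.
have /leq_trans-> // : k.+4 ^ 2 <= k.+2 * k.+3 ^ 2 by nia.
by rewrite [9 * _]mulnCA leq_mul2l IHk orbT.
Qed.

Lemma leq_sqr_bin n k : k.+2 ^ 2 * 'C(n, k) <= 9 * n ^ k.
Proof.
apply: leq_trans (leq_mul (leq_sqr_fact k) (leqnn _)) _.
by rewrite -mulnA leq_mul2l mulnC bin_ffact leq_ffact_exp orbT.
Qed.

(** * Matchings and small covers of common links *)

Lemma matching_cover (V : finType) (k t : nat) (L : {set {set V}}) :
    0 < k -> {in L, forall Y : {set V}, #|Y| = k} ->
    (forall P : {set {set V}}, P \subset L -> trivIset P -> #|P| < t) ->
  exists C : {set V}, #|C| <= k * t /\ {in L, forall Y : {set V}, ~~ [disjoint Y & C]}.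
Proof.
move=> k_gt0 cardL matchL.
pose matching (P : {set {set V}}) := (P \subset L) && trivIset P.
have matching0 : matching set0.
  by rewrite /matching sub0set; apply/trivIsetP => A; rewrite inE.
case: (arg_maxnP (fun P : {set {set V}} => #|P|) matching0) => P /andP[sPL tP] maxP.
exists (cover P); split.
  apply: leq_trans (leq_card_cover P).1 _.
  rewrite (eq_bigr (fun _ => k)) => [|Y /(subsetP sPL)/cardL //].
  by rewrite sum_nat_const mulnC leq_mul2l ltnW ?orbT ?matchL.
(* A member disjoint from the cover would enlarge the maximum matching [P]; it is new because
   members are nonempty. *)
move=> Y LY; apply/negP => dYP.
have [|||tYP nPY] := @trivIsetU1 _ Y P.
- move=> B PB; apply: disjointWr dYP.
  exact: (bigcup_sup B).
- by [].
- by apply/negP => /(subsetP sPL)/cardL; rewrite cards0 => k0; rewrite -k0 in k_gt0.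
have := maxP (Y |: P); rewrite /matching tYP subUset sub1set LY sPL.
by move=> /(_ isT); rewrite cardsU1 nPY; lia.
Qed.

Lemma matching_copy (V : finType) (s t r : nat) (G : {set {set V}})
    (X : {set V}) (P : {set {set V}}) :
    0 < r -> uniform r G -> #|X| = s -> t <= #|P| ->
    trivIset P -> {in P, forall Y : {set V}, #|Y| = r.-1} ->
    {in X & P, forall (x : V) (Y : {set V}), x |: Y \in G} ->
  contains_copy G (Kst s t r).
Proof.
move=> r_gt0 /forall_inP unifG cardX le_tP tP cardP XPG.
pose Yi (i : 'I_t) : {set V} := enum_val (widen_ord le_tP i).
have PYi i : Yi i \in P by apply: enum_valP.
have cardYi i : r.-1 = #|Yi i| by rewrite cardP.
pose F (w : Kvertex s t r) : V := match w with
  | inl x => enum_val (cast_ord (esym cardX) x)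
  | inr (i, j) => enum_val (cast_ord (cardYi i) j)
  end.
have FX x : F (inl x) \in X by apply: enum_valP.
have FY i j : F (inr (i, j)) \in Yi i by apply: enum_valP.
(* Uniformity separates [X] from the blocks: [x] in [Yi i] would give an edge with only [r - 1]
   vertices. *)
have dXY x i : F (inl x) \notin Yi i.
  apply/negP => xYi; have /eqP := unifG _ (XPG _ _ (FX x) (PYi i)).
  by rewrite cardsU1 xYi -cardYi; lia.
have Yi_inj i i' v : v \in Yi i -> v \in Yi i' -> i = i'.
  move=> vi vi'; apply/eqP; apply: contraTT vi' => ne_ii'.
  have /trivIsetP/(_ _ _ (PYi i) (PYi i')) := tP.
  rewrite (inj_eq enum_val_inj) -val_eqE /= => /(_ ne_ii') dij.
  by rewrite (disjointFr dij vi).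
apply/existsP; exists [ffun w => F w]; apply/andP; split.
  apply/injectiveP => -[x|[i j]] [x'|[i' j']]; rewrite !ffunE => eqF.
  - by congr inl; apply: (cast_ord_inj (enum_val_inj eqF)).
  - by have := dXY x i'; rewrite eqF FY.
  - by have := dXY x' i; rewrite -eqF FY.
  have eq_ii' : i = i' by apply: (Yi_inj _ _ (F (inr (i, j)))); rewrite // eqF.
  by rewrite -eq_ii' in j' eqF *; rewrite (cast_ord_inj (enum_val_inj eqF)).
apply/forall_inP => e /imset2P[x i _ _ ->].
suff -> : [set [ffun w => F w] w | w in inl x |: Kblock s r i] = F (inl x) |: Yi i.
  exact: XPG.
rewrite imsetU1 ffunE; congr (_ |: _); apply/setP => v.
apply/imsetP/idP => [[_ /imsetP[j _ ->] ->]|vYi]; first by rewrite ffunE.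
pose j := cast_ord (esym (cardYi i)) (enum_rank_in vYi v).
exists (inr (i, j)); first exact: imset_f.
by rewrite ffunE /= /j cast_ordKV enum_rankK_in.
Qed.

Definition nbr (V : finType) (G : {set {set V}}) (Y : {set V}) : {set V} :=
  [set x | x |: Y \in G].

(** Pairwise disjoint members of the common link of [X], [t] in number, would form a copy together
    with [X]; so [matching_cover] applies. *)
Lemma common_link_cover (V : finType) (s t r : nat) (G : {set {set V}}) :
    1 < r -> uniform r G -> ~~ contains_copy G (Kst s t r) ->
  exists C : {set V} -> {set V},
    (forall X : {set V}, #|X| = s -> #|C X| <= r.-1 * t) /\
    (forall X Y : {set V}, #|X| = s -> #|Y| = r.-1 -> X \subset nbr G Y ->
       ~~ [disjoint Y & C X]).
Proof.
move=> r_gt1 unifG freeG.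
have coverX (X : {set V}) : exists C : {set V}, #|X| = s ->
    #|C| <= r.-1 * t /\
    forall Y : {set V}, #|Y| = r.-1 -> X \subset nbr G Y -> ~~ [disjoint Y & C].
  have [cX|nX] := eqVneq #|X| s; last by exists set0 => cX; rewrite cX eqxx in nX.
  pose L := [set Y : {set V} | (#|Y| == r.-1) && (X \subset nbr G Y)].
  have [||P sPL tP|C [cC hitC]] := @matching_cover V r.-1 t L; first by lia.
  - by move=> Y; rewrite inE => /andP[/eqP].
  - rewrite ltnNge; apply: contra freeG => le_tP.
    apply: (@matching_copy _ _ _ _ _ X P) => //; first by lia.
      by move=> Y /(subsetP sPL); rewrite inE => /andP[/eqP].
    move=> x Y Xx /(subsetP sPL); rewrite inE => /andP[_ /subsetP/(_ x Xx)].
    by rewrite inE.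
  exists C => _; split=> // Y cY sXN; apply: hitC.
  by rewrite inE cY eqxx.
have [C hC] := fin_all_exists coverX.
by exists C; split=> [X /hC[]|X Y /hC[_]] //; apply.
Qed.

(** * Double counting of sets through given vertices *)

Lemma leq_card_containing_pair (V : finType) (k : nat) (v x : V) : v != x ->
  #|[set Y : {set V} | [&& #|Y| == k.+2, v \in Y & x \in Y]]| <= 'C(#|V|, k).
Proof.
move=> ne_vx; rewrite -card_draws.
rewrite -(@card_in_imset _ _ (fun Y => Y :\ v :\ x)).
  apply/subset_leq_card/subsetP => _ /imsetP[Y + ->].
  rewrite !inE => /and3P[/eqP cY vY xY].
  have := cardsD1 v Y; have := cardsD1 x (Y :\ v).
  by rewrite !inE eq_sym ne_vx xY vY cY => /= ->; lia.
move=> Y Z; rewrite !inE => /and3P[_ vY xY] /and3P[_ vZ xZ] eqYZ.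
rewrite -(setD1K vY) -(setD1K vZ); congr (_ |: _).
by rewrite -(setD1K (_ : x \in Y :\ v)) ?eqYZ ?setD1K ?inE 1?eq_sym ?ne_vx.
Qed.

Lemma leq_card_subsets_at (V : finType) (k : nat) (N : {set V}) (x : V) :
  x \in N ->
  'C(#|N|.-1, k) <=
    #|[set X : {set V} | [&& #|X| == k.+1, x \in X & X \subset N]]|.
Proof.
move=> Nx; have -> : #|N|.-1 = #|N :\ x| by rewrite (cardsD1 x N) Nx.
rewrite -cards_draws -(@card_in_imset _ _ (fun A => x |: A)).
  apply/subset_leq_card/subsetP => _ /imsetP[A + ->].
  rewrite !inE => /andP[sAN /eqP cA]; rewrite eqxx /= subUset sub1set Nx.
  have [sA nxA] := (subsetD1P sAN); rewrite cardsU1 nxA cA.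
  by rewrite sA eqxx.
move=> A B; rewrite !inE => /andP[/subsetD1P[_ nA] _] /andP[/subsetD1P[_ nB] _].
by move=> eqAB; rewrite -(setU1K nA) eqAB setU1K.
Qed.

(** The quantity [F v x] of the overview, as a sum of products of Booleans so that sums can be
    exchanged. *)
Definition incidence (V : finType) (s : nat) (C : {set V} -> {set V})
    (v x : V) : nat :=
  \sum_(X : {set V} | #|X| == s) (x \in X) * (v \in C X).

(** After exchanging sums, each [X] contributes [#|X| * #|C X|]. *)
Lemma sum_incidence (V : finType) (s b : nat) (C : {set V} -> {set V}) :
    (forall X : {set V}, #|X| = s -> #|C X| <= b) ->
  \sum_v \sum_x incidence s C v x <= 'C(#|V|, s) * (s * b).
Proof.
move=> cardC; under eq_bigr do rewrite exchange_big /=.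
rewrite exchange_big /= -card_draws -sum_nat_const.
rewrite [leqRHS](eq_bigl (fun X : {set V} => #|X| == s)); last by move=> X; rewrite inE.
apply: leq_sum => X /eqP cX.
under eq_bigr do rewrite -big_distrl /=.
rewrite -big_distrr /= -!big_mkcond /= !sum1_card cX leq_mul2l.
by rewrite cardC ?orbT.
Qed.

(** Each [X] counted by the binomial contributes to the term of some [v], namely any point of
    [Y :&: C X]. *)
Lemma bin_leq_incidence (V : finType) (s : nat) (C : {set V} -> {set V})
    (N Y : {set V}) (x : V) : x \in N ->
    (forall X : {set V}, #|X| = s.+1 -> X \subset N -> ~~ [disjoint Y & C X]) ->
  'C(#|N|.-1, s) <= \sum_(v in Y) incidence s.+1 C v x.
Proof.
move=> Nx hitC; apply: leq_trans (leq_card_subsets_at _ Nx) _.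
rewrite /incidence exchange_big /= -sum1_card.
rewrite [leqRHS]big_mkcond [leqLHS]big_mkcond; apply: leq_sum => X _.
rewrite inE; case: eqP => //= cX; case: ifP => // /andP[xX sXN].
rewrite xX; have := hitC X cX sXN.
rewrite -setI_eq0 => /set0Pn[v]; rewrite inE => /andP[vY vC].
by rewrite (bigD1 v) //= vC.
Qed.

(** * Heavy and light edges *)

Lemma heavy_edge_incidence (V : finType) (k s m : nat) (G : {set {set V}})
    (C : {set V} -> {set V}) (e : {set V}) :
    e \in G -> #|e| = k.+3 -> s.+1.*2 <= m ->
    (forall X Y : {set V}, #|X| = s.+1 -> #|Y| = k.+2 -> X \subset nbr G Y ->
       ~~ [disjoint Y & C X]) ->
    {in e, forall y, m <= #|nbr G (e :\ y)|} ->
  exists v x y, [/\ v != x, v \in e :\ y, x \in e :\ y, y \in e &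
    #|nbr G (e :\ y)| ^ s
      <= 2 ^ s * s`! * (k.+2 * incidence s.+1 C v x)].
Proof.
move=> Ge ce le_sm hitC heavy.
have cD1 z : z \in e -> #|e :\ z| = k.+2.
  by move=> ez; have := cardsD1 z e; rewrite ez ce => -[].
have [z ez] : exists z, z \in e by apply/card_gt0P; rewrite ce.
have [x ex maxx] := arg_maxnP (fun x => #|nbr G (e :\ x)|) ez.
have xN : x \in nbr G (e :\ x) by rewrite inE setD1K.
have [w xw] : exists w, w \in e :\ x by apply/card_gt0P; rewrite cD1.
(* The best [v] has incidence at least the average over the [k.+2] vertices of [e :\ x]. *)
have [v vY maxv] := arg_maxnP (fun v => incidence s.+1 C v x) xw.
have {}vY : v \in e :\ x := vY.
have /setD1P[ne_vx ev] := vY.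
(* A third vertex exists as [#|e| >= 3]. Then [e :\ y] contains both [v] and [x], which leaves at
   most ['C(#|V|, k)] choices for it given the pair. *)
have [y /setD1P[ne_yv /setD1P[ne_yx ey]]] : exists y, y \in e :\ x :\ v.
  by apply/card_gt0P; have := cardsD1 v (e :\ x); rewrite vY cD1 // add1n => -[<-].
exists v, x, y; split=> //; first by rewrite !inE eq_sym ne_yv.
  by rewrite !inE eq_sym ne_yx.
apply: leq_trans (leq_exp_bin (leq_trans le_sm (heavy y ey))) _.
rewrite leq_mul2l; apply/orP; right.
apply: leq_trans (_ : 'C(#|nbr G (e :\ x)|.-1, s) <= _).
  by apply: leq_bin2l; rewrite -!subn1 leq_sub2r //; apply: maxx.
apply: leq_trans (bin_leq_incidence xN (fun X cX => hitC X _ cX (cD1 x ex))) _.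
rewrite -(cD1 x ex) -sum_nat_const; apply: leq_sum => u uY.
exact: maxv.
Qed.

Lemma leq_card_light_edges (V : finType) (k m : nat) (G : {set {set V}}) :
  uniform k.+1 G ->
  #|[set e in G | [exists y in e, #|nbr G (e :\ y)| < m]]| <= m * #|V| ^ k.
Proof.
move=> /forall_inP unifG.
pose light (Y : {set V}) := (#|Y| == k) && (#|nbr G Y| < m).
apply: (@leq_trans #|\bigcup_(Y | light Y) [set y |: Y | y in nbr G Y]|).
  apply/subset_leq_card/subsetP => e; rewrite inE => /andP[Ge /exists_inP[y ey lty]].
  apply/bigcupP; exists (e :\ y).
    by have := cardsD1 y e; rewrite /light ey (eqP (unifG e Ge)) lty add1n => -[<-]; rewrite eqxx.
  by apply/imsetP; exists y; rewrite ?inE setD1K.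
apply: leq_trans (leq_card_bigcup _ _) _.
apply: (@leq_trans (\sum_(Y : {set V} | light Y) m)).
  by apply: leq_sum => Y /andP[_ /ltnW]; apply: leq_trans; apply: leq_imset_card.
rewrite sum_nat_const mulnC leq_mul2l; apply/orP; right.
apply: leq_trans (leq_bin_exp _ _); rewrite -card_draws; apply: subset_leq_card.
by apply/subsetP => Y; rewrite !inE => /andP[].
Qed.

(** A triple [(v, x, Y)] accounts for at most [d = #|nbr G Y|] edges. The weight [m ^ s] serves to
    use [m ^ s * d <= d ^ s.+1], which [heavy_edge_incidence] bounds by an incidence. *)
Lemma leq_card_heavy_edges (V : finType) (k s m b : nat) (G : {set {set V}})
    (C : {set V} -> {set V}) :
    uniform k.+3 G -> s.+2.*2 <= m ->
    (forall X : {set V}, #|X| = s.+2 -> #|C X| <= b) ->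
    (forall X Y : {set V}, #|X| = s.+2 -> #|Y| = k.+2 -> X \subset nbr G Y ->
       ~~ [disjoint Y & C X]) ->
  m ^ s * #|[set e in G | [forall y in e, m <= #|nbr G (e :\ y)|]]|
    <= 2 ^ s.+1 * s.+1`! * (k.+2 * ('C(#|V|, k) * ('C(#|V|, s.+2) * (s.+2 * b)))).
Proof.
move=> /forall_inP unifG le_sm cardC hitC; set K := 2 ^ _ * _.
pose F := incidence s.+2 C.
pose good (p : V * V) (Y : {set V}) :=
  [&& #|Y| == k.+2, p.1 \in Y & p.2 \in Y]
  && (m <= #|nbr G Y|) && (#|nbr G Y| ^ s.+1 <= K * (k.+2 * F p.1 p.2)).
apply: (@leq_trans (m ^ s * #|\bigcup_(p | p.1 != p.2) \bigcup_(Y | good p Y)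
                               [set y |: Y | y in nbr G Y]|)).
  rewrite leq_mul2l; apply/orP; right.
  apply/subset_leq_card/subsetP => e; rewrite inE => /andP[Ge /forall_inP heavy].
  have ce := eqP (unifG e Ge).
  have [v [x [y [ne_vx vY xY ey le_d]]]] :=
    heavy_edge_incidence Ge ce le_sm hitC heavy.
  apply/bigcupP; exists (v, x) => //; apply/bigcupP; exists (e :\ y).
    rewrite /good vY xY heavy // le_d !andbT.
    by have := cardsD1 y e; rewrite ey ce add1n => -[<-].
  by apply/imsetP; exists y; rewrite ?inE setD1K.
apply: (@leq_trans (\sum_(p : V * V | p.1 != p.2)
                      K * (k.+2 * ('C(#|V|, k) * F p.1 p.2)))).
  apply: leq_trans (leq_mul (leqnn _) (leq_card_bigcup _ _)) _.
  rewrite big_distrr /=; apply: leq_sum => -[v x] /= ne_vx.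
  apply: leq_trans (leq_mul (leqnn _) (leq_card_bigcup _ _)) _.
  rewrite big_distrr /=.
  apply: (@leq_trans (\sum_(Y | good (v, x) Y) K * (k.+2 * F v x))).
    apply: leq_sum => Y /andP[/andP[_ le_mN]]; apply: leq_trans.
    rewrite expnSr leq_mul ?leq_imset_card //.
    by case: (s) => // s'; rewrite leq_exp2r.
  rewrite sum_nat_const [k.+2 * ('C(_, _) * _)]mulnCA [leqRHS]mulnCA leq_mul2r; apply/orP; right.
  apply: leq_trans (leq_card_containing_pair k ne_vx).
  by apply/subset_leq_card/subsetP => Y; rewrite inE => /andP[/andP[]].
rewrite -!big_distrr /= !leq_mul2l; apply/orP; right; apply/orP; right; apply/orP; right.
apply: leq_trans (sum_incidence cardC); rewrite [leqRHS]pair_big /=.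
by rewrite [leqLHS]big_mkcond; apply: leq_sum => p _; case: ifP.
Qed.

(** * The Turán bound in natural numbers *)

Definition turan_const (s : nat) : nat := 9 * (2 ^ s.+1 * s.+1`!) * s.+2 + 1.

(** The theorem's [s] and [r] are here [s.+2] and [k.+3]. In [turan_const] the summand 1 pays for
    light edges; for heavy ones, 9 comes from [leq_sqr_bin], the power and factorial from
    [leq_exp_bin], and [s.+2] is the size of [X]. *)
Lemma turan_Kst_leq (n k s t m : nat) :
    s.+2.*2 <= m -> t * n ^ s <= m ^ s.+1 ->
  turan k.+3 n (Kst s.+2 t k.+3) <= turan_const s * m * n ^ k.+2.
Proof.
move=> le_sm le_tm; apply/bigmax_leqP => G /andP[unifG freeG].
have [C [cardC hitC]] := common_link_cover (isT : 1 < k.+3) unifG freeG.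
pose H := [set e in G | [forall y in e, m <= #|nbr G (e :\ y)|]].
pose L := [set e in G | [exists y in e, #|nbr G (e :\ y)| < m]].
have -> : G = H :|: L.
  apply/setP => e; rewrite !inE -andb_orr; case: (e \in G) => //=.
  apply/esym; rewrite -implyNb negb_forall_in; apply/implyP.
  by move=> /exists_inP[y ey]; rewrite -ltnNge => lt; apply/exists_inP; exists y.
apply: leq_trans (leq_card_setU _ _) _.
have leL := leq_card_light_edges m unifG.
have leH := leq_card_heavy_edges unifG le_sm cardC hitC.
rewrite card_ord in leL leH.
rewrite /turan_const mulnDl mulnDl mul1n leq_add //.
rewrite -(@leq_pmul2l (m ^ s)) ?expn_gt0; last by apply/orP; left; lia.
apply: leq_trans leH _; set K := 2 ^ _ * _.
(* One [k.+2] comes from the cover size [k.+2 * t], the other from averaging over [e :\ x]. *)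
apply: (@leq_trans (K * s.+2 * (k.+2 ^ 2 * 'C(n, k)) * n ^ s.+2 * t)).
  rewrite [leqLHS](_ : _ = K * s.+2 * (k.+2 ^ 2 * 'C(n, k)) * 'C(n, s.+2) * t).
    by rewrite leq_mul // leq_mul // leq_bin_exp.
  by rewrite /=; ring.
apply: (@leq_trans (K * s.+2 * (9 * n ^ k) * n ^ s.+2 * t)).
  by rewrite leq_mul // leq_mul // leq_mul // leq_sqr_bin.
rewrite [leqLHS](_ : _ = 9 * K * s.+2 * n ^ k.+2 * (t * n ^ s)); last first.
  by rewrite !expnS; ring.
rewrite [leqRHS](_ : _ = 9 * K * s.+2 * n ^ k.+2 * m ^ s.+1); last first.
  by rewrite !expnS; ring.
by rewrite leq_mul2l le_tm orbT.
Qed.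

(** * Choice of the threshold and real exponents *)

Local Open Scope ring_scope.

(** The real solution of [a ^+ s.+1 = t * n ^ s] is rounded up and increased by [s.+2.*2]; since
    [a >= 1], the added constant is at most a multiple of [a]. *)
Lemma threshold_exists (R : realType) (s t n : nat) : (0 < t)%N -> (0 < n)%N ->
  exists m : nat, [/\ (s.+2.*2 <= m)%N, (t * n ^ s <= m ^ s.+1)%N &
    m%:R <= s.+2.*2.+2%:R * (t%:R `^ s.+1%:R^-1 * n%:R `^ (1 - s.+1%:R^-1)) :> R].
Proof.
move=> t_gt0 n_gt0; set p : R := s.+1%:R^-1.
have p_ge0 : 0 <= p by rewrite invr_ge0.
have p_le1 : p <= 1 by rewrite invf_le1 // ler1n.
have ps1 : p * s.+1%:R = 1 by rewrite mulVf ?pnatr_eq0.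
set a : R := _ * _ `^ _.
have powR_ge1 (x : nat) (q : R) : (0 < x)%N -> 0 <= q -> 1 <= x%:R `^ q :> R.
  by move=> x_gt0 q_ge0; rewrite -[leLHS](powRr0 x%:R) ler_powR // ler1n.
have a_ge1 : 1 <= a by rewrite mulr_ege1 // powR_ge1 // subr_ge0.
have a_ge0 : 0 <= a by apply: le_trans a_ge1.
have aX : a ^+ s.+1 = t%:R * n%:R ^+ s.
  rewrite exprMn -!powR_mulrn ?powR_ge0 // -!powRrM ps1 powRr1 //.
  congr (_ * _ `^ _).
  by rewrite mulrBl mul1r ps1 -natr1 addrK.
exists (s.+2.*2 + Num.truncn a).+1; split.
- by lia.
- rewrite -(ler_nat R) natrM !natrX -aX lerXn2r ?nnegrE //.
  apply: ltW; apply: lt_le_trans (truncnS_gt a) _.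
  by rewrite ler_nat ltnS leq_addl.
- rewrite -addSn -[_.*2.+2]addn1 !natrD mulrDl mul1r.
  by rewrite lerD ?truncn_le // ler_peMr.
Qed.

Theorem theorem1p1 (R : realType) :
  (forall s : nat, (2 <= s)%N ->
     exists C : R, forall t r n : nat,
       (2 <= t)%N -> (3 <= r)%N -> (0 < n)%N ->
       (turan r n (Kst s t r))%:R <=
         C * t%:R `^ (1 / (s%:R - 1)) * n%:R `^ (r%:R - 1 / (s%:R - 1)))
  /\
  (exists C : R, forall t n : nat,
     (2 <= t)%N -> (turan 3 n (Kst 2 t 3))%:R <= C * t%:R * n%:R ^+ 2).
Proof.
have main (s : nat) : (2 <= s)%N ->
     exists C : R, forall t r n : nat,
       (2 <= t)%N -> (3 <= r)%N -> (0 < n)%N ->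
       (turan r n (Kst s t r))%:R <=
         C * t%:R `^ (1 / (s%:R - 1)) * n%:R `^ (r%:R - 1 / (s%:R - 1)).
  case: s => [|[|s]] // _.
  exists ((turan_const s)%:R * s.+2.*2.+2%:R) => t [|[|[|k]]] // n t_gt1 _ n_gt0.
  have [m [le_sm le_tm le_m]] := threshold_exists R s (ltnW t_gt1) n_gt0.
  have n_neq0 : n%:R != 0 :> R by rewrite pnatr_eq0 -lt0n.
  have -> : s.+2%:R - 1 = s.+1%:R :> R by rewrite -natr1 addrK.
  rewrite div1r; set p : R := s.+1%:R^-1 in le_m *.
  (* Separates the factor [n ^ (1 - p)] of the threshold from the [n ^ (r - 1)] of
     [turan_Kst_leq]. *)
  have -> : k.+3%:R - p = (1 - p) + k.+2%:R by rewrite -natr1; ring.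
  rewrite powRD ?n_neq0 ?implybT // powR_mulrn ?ler0n //.
  have := turan_Kst_leq k le_sm le_tm.
  rewrite -(ler_nat R) natrM natrX natrM => /le_trans-> //.
  rewrite mulrA ler_wpM2r ?exprn_ge0 //.
  by rewrite -!mulrA ler_wpM2l.
split=> //.
(* For [n = 0], which [main] excludes, there are no edges of size 3; otherwise the exponents reduce
   to 1 and 2. *)
have [C hC] := main 2 isT; exists C => t [|n] t_gt1.
  rewrite expr0n mulr0 lern0 -leqn0.
  apply/bigmax_leqP => G /andP[/forall_inP unifG _].
  rewrite leqn0 cards_eq0; apply/eqP/setP => e; rewrite inE.
  apply/negP => /unifG/eqP ce; have := max_card e.
  by rewrite ce card_ord.
have := hC t 3 n.+1 t_gt1 isT isT.
have -> : 2%:R - 1 = 1 :> R by ring.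
rewrite divr1 powRr1 ?ler0n //.
have -> : 3%:R - 1 = 2%:R :> R by ring.
by rewrite powR_mulrn ?ler0n.
Qed.
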